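(* There is a function $\delta:\mathbb{N}\to\mathbb{R}$ with $\delta(n)\to 0$ as $n\to\infty$ such that the following holds. Let $G$ be a $d$-regular graph on $n$ vertices, and let $\lambda_2$ be the second largest eigenvalue of the adjacency matrix of $G$. Then for every $\varepsilon>0$, $$\lambda_2\geq \begin{cases} \frac{\sqrt{d}}{2}\,(1-\delta(n)) &\mbox{ if } 1\leq d\leq n^{2/3},\\ \frac{n}{2d}-1 &\mbox{ if } n^{2/3}< d\leq n^{3/4},\\ (\varepsilon/4)^{1/3}\cdot d^{1/3}-1 &\mbox{ if } n^{3/4}< d\leq (1/2-\varepsilon)n. \end{cases}$$
   Context: Graphs are finite, simple and undirected. The eigenvalues of the adjacency matrix are real and are listed with multiplicity in non-increasing order $d=\lambda_1\geq\lambda_2\geq\dots\geq\lambda_n$. The function $\delta$ makes explicit the $o(1)$-term, which tends to $0$ as $n\to\infty$. *)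

(* Defs.v *)
From mathcomp Require Import all_boot all_order all_algebra.
From mathcomp Require Import all_classical all_reals all_analysis.
From mathcomp Require Import spectral complex.
Set Implicit Arguments. Unset Strict Implicit. Unset Printing Implicit Defensive.
Import Order.TTheory GRing.Theory Num.Theory.
Local Open Scope ring_scope.

(* The rows and columns are indexed through the canonical enumeration of T;
   renumbering the vertices only conjugates the matrix by a permutation. *)
Definition adjacency (R : realType) (T : finType) (e : rel T) : 'M[R]_#|T| :=
  \matrix_(i, j) (e (enum_val i) (enum_val j))%:R.

Definition regular_graph (T : finType) (e : rel T) (d : nat) : Prop :=
  forall x : T, #|[set y | e x y]| = d.

(* s lists the eigenvalues of A with (algebraic) multiplicity in non-increasing
   order; the list is 0-indexed, so the second largest eigenvalue is s`_1. *)
Definition is_spectrum (R : realType) (n : nat) (A : 'M[R]_n) (s : seq R) :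
  Prop := sorted >=%R s /\ char_poly A = \prod_(x <- s) ('X - x%:P).

Lemma is_spectrum_size (R : realType) (n : nat) (A : 'M[R]_n) (s : seq R) :
  is_spectrum A s -> size s = n.
Proof.
by case=> _ /(congr1 (size \o val)) /=; rewrite size_char_poly size_prod_XsubC => -[].
Qed.

Lemma is_spectrum_uniq (R : realType) (n : nat) (A : 'M[R]_n) (s t : seq R) :
  is_spectrum A s -> is_spectrum A t -> s = t.
Proof.
move=> [ss es] [st et]; apply: (sorted_eq ge_trans ge_anti) => //.
by apply/prod_XsubC_eq; rewrite -es -et.
Qed.

Lemma char_poly_conj (F : fieldType) (n : nat) (P D : 'M[F]_n) :
  P \in unitmx -> char_poly (invmx P *m D *m P) = char_poly D.
Proof.
move=> Pu; rewrite /char_poly /char_poly_mx !map_mxM /=.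
have PV : map_mx polyC (invmx P) *m map_mx polyC P = 1%:M.
  by rewrite -map_mxM mulVmx // map_mx1.
have -> : 'X%:M - map_mx polyC (invmx P) *m map_mx polyC D *m map_mx polyC P =
  map_mx polyC (invmx P) *m ('X%:M - map_mx polyC D) *m map_mx polyC P.
  by rewrite mulmxBr mulmxBl mul_mx_scalar -scalemxAl PV scalemx1.
by rewrite !det_mulmx mulrAC -det_mulmx PV det1 mul1r.
Qed.

Lemma symmetric_has_spectrum (R : realType) (n : nat) (A : 'M[R]_n) :
  A^T = A -> exists s : seq R, is_spectrum A s.
Proof.
move=> Asym.
pose B : 'M[R[i]]_n := map_mx (real_complex R) A.
have Bh : B \is hermsymmx.
  apply: realsym_hermsym.
    apply/is_hermitianmxP; rewrite expr0 scale1r map_mx_id //.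
    by rewrite /B map_trmx Asym.
  by apply/mxOverP => i j; rewrite mxE; apply/complex_realP; exists (A i j).
have Dr := hermitian_spectral_diag_real Bh.
have /orthomx_spectralP eB := hermitian_normalmx Bh.
set D := spectral_diag B in Dr eB.
pose t := [seq complex.Re (D 0 i) | i <- enum 'I_n].
exists (sort >=%R t); split; first exact: (sort_sorted ge_total).
rewrite (perm_big t) /=; last by rewrite perm_sort.
apply: (@map_poly_inj _ _ (real_complex R)).
rewrite map_char_poly -/B eB char_poly_conj ?spectral_unit //.
rewrite char_poly_trig; last exact/diag_mx_is_trig.
rewrite rmorph_prod /= /t big_map big_enum /=; apply: eq_bigr => i _.
rewrite rmorphB /= map_polyX map_polyC /= !mxE eqxx mulr1n.
by congr ('X - _%:P); rewrite RRe_real //; apply/mxOverP.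
Qed.

Lemma adjacency_sym (R : realType) (T : finType) (e : rel T) :
  symmetric e -> (adjacency R e)^T = adjacency R e.
Proof. by move=> es; apply/matrixP => i j; rewrite !mxE es. Qed.

(* Main.v *)
Require Import Defs.
From mathcomp Require Import all_boot all_order all_algebra.
From mathcomp Require Import all_classical all_reals all_analysis.
From mathcomp Require Import spectral complex ring lra zify.
Set Implicit Arguments. Unset Strict Implicit. Unset Printing Implicit Defensive.
Import Order.TTheory GRing.Theory Num.Theory.
Import numFieldNormedType.Exports.
Local Open Scope classical_set_scope.
Local Open Scope ring_scope.

(** Write A for the adjacency matrix, J for the all-ones matrix, lam for the
second eigenvalue and a = (d - lam) / n.  The constant vector is an eigenvector
of A for the eigenvalue d, and every other eigenvalue is at most lam, so
    M = lam I - A + a J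
kills the constant vector and has the eigenvalues lam - lam_i >= 0 elsewhere:
M is positive semidefinite, hence a Gram matrix ([regular_graph_gram]).  Its
entries are lam + a on the diagonal, a - 1 on edges and a on non-edges, and all
the bounds come from testing positivity in three ways.

- The vector with entries 1 and -1 at two vertices x and y gives lam >= -1, and
  lam >= 0 as soon as the graph is not complete ([snd_eigenvalue_pair],
  [snd_eigenvalue_ge0]).

- The indicator of the neighbourhood of a vertex, plus t at the vertex itself,
  gives
      2 t n d <= lam n (d + t^2) + (d - lam) (d + t)^2,
  because its quadratic form for A is at least 2 t d, the contribution of the
  triangles being nonnegative ([snd_eigenvalue_local]).  If d^3 <= n^2, then
  t = sqrt d yields essentially lam >= sqrt d - d^2 / (2 n) >= sqrt d / 2, with
  an error of relative size O(n^(-1/3)); this is why delta n = 9 / n^(1/3).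
  If d^3 >= n^2 and d < n / 2, then t = 2 d^2 / n yields lam >= n / (2 d) - 1;
  if d >= n / 2, this bound is at most 0 and the graph is not complete.

- The entrywise cube of a positive semidefinite matrix is positive
  semidefinite, so the cubes of the entries of M have a nonnegative sum
  ([snd_eigenvalue_cube]):
      d (1 - a)^3 <= (lam + a)^3 + (n - 1 - d) a^3.
  Since a <= d / n <= 1/2 - eps, this forces (lam + 1)^3 >= eps d. *)

(** * Gram vectors from the spectrum *)

Local Open Scope sesquilinear_scope.
Local Open Scope complex_scope.

(** The list s is only given through the characteristic polynomial; what the
proofs need is a unitary diagonalization whose diagonal is a rearrangement of
s.  The eigenvectors may be complex: only their real and imaginary parts are
used later. *)
Lemma symmetric_spectral_resolution (R : realType) (n : nat) (A : 'M[R]_n)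
    (s : seq R) : A^T = A -> is_spectrum A s ->
  exists (P : 'M[R[i]]_n) (D : 'I_n -> R),
    [/\ P \is unitarymx, perm_eq [seq D k | k <- enum 'I_n] s &
        map_mx (real_complex R) A =
          P^t* *m diag_mx (\row_k (D k)%:C) *m P].
Proof.
move=> Asym spA.
pose B : 'M[R[i]]_n := map_mx (real_complex R) A.
have Bh : B \is hermsymmx.
  apply: realsym_hermsym.
    apply/is_hermitianmxP; rewrite expr0 scale1r map_mx_id //.
    by rewrite /B map_trmx Asym.
  by apply/mxOverP => i j; rewrite mxE; apply/complex_realP; exists (A i j).
have /mxOverP Dr := hermitian_spectral_diag_real Bh.
have /orthomx_spectralP eB := hermitian_normalmx Bh.
have Pu := spectral_unitarymx B.
pose D k := complex.Re (spectral_diag B 0 k).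
have eD : spectral_diag B = \row_k (D k)%:C.
  by apply/rowP => k; rewrite mxE RRe_real.
exists (spectralmx B), D; split=> //; last first.
  by rewrite -invmx_unitary // -eD.
case: spA => _ spA; apply/prod_XsubC_eq; rewrite -spA.
apply: (@map_poly_inj _ _ (real_complex R)).
rewrite map_char_poly -/B eB char_poly_conj ?spectral_unit //.
rewrite char_poly_trig; last exact/diag_mx_is_trig.
rewrite rmorph_prod /= big_map big_enum /=; apply: eq_bigr => i _.
by rewrite rmorphB /= map_polyX map_polyC /= !mxE eqxx mulr1n RRe_real.
Qed.

(** Descent from the complex to the real numbers: the real part of
conj(p) * p' is Re p * Re p' + Im p * Im p', so the real and the imaginary parts
of the rows of P, scaled by the square roots of E, are Gram vectors over R. *)
Lemma psd_gram (R : realType) (n : nat) (M : 'M[R]_n) (P : 'M[R[i]]_n)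
    (E : 'I_n -> R) : (forall k, 0 <= E k) ->
  map_mx (real_complex R) M = P^t* *m diag_mx (\row_k (E k)%:C) *m P ->
  exists B : 'M[R]_(n + n, n), M = B^T *m B.
Proof.
move=> E0 eM.
pose Bre := \matrix_(k, j) (Num.sqrt (E k) * complex.Re (P k j)).
pose Bim := \matrix_(k, j) (Num.sqrt (E k) * complex.Im (P k j)).
exists (col_mx Bre Bim).
rewrite tr_col_mx mul_row_col; apply/matrixP => i j.
have -> : M i j = complex.Re (map_mx (real_complex R) M i j) by rewrite mxE.
rewrite eM mul_mx_diag !mxE raddf_sum -big_split; apply: eq_bigr => k _.
rewrite !mxE -[in LHS](sqr_sqrtr (E0 k)); move: (Num.sqrt _) => r.
case: (P k i) => a b; case: (P k j) => a' b'; rewrite /=.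
ring.
Qed.

(** In a non-increasing list, only the head can exceed the second entry. *)
Lemma spectrum_above_snd (R : realType) (n : nat) (D : 'I_n -> R) (s : seq R) :
  perm_eq [seq D k | k <- enum 'I_n] s -> sorted >=%R s ->
  forall k l, s`_1 < D k -> s`_1 < D l -> k = l.
Proof.
move=> /permP pDs ss.
have c1 : (count (fun x => (s`_1 < x)%R) s <= 1)%N.
  case: s ss {pDs} => [|x [|y s]] //= ; first by case: ltP.
  case/andP=> _ /(order_path_min ge_trans)/allP ys.
  rewrite ltxx add0n (_ : count _ s = 0%N) ?addn0 ?leq_b1 //.
  by apply/eqP; rewrite -leqn0 leqNgt -has_count -all_predC; apply/allP=> z /ys;
     rewrite /= -leNgt.
move=> k l hk hl.
have /card_le1_eqP : (#|[pred k | (s`_1 < D k)%R]| <= 1)%N.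
  by move: c1; rewrite -pDs count_map cardE enumT size_filter.
by apply.
Qed.

(** Write lam for s`_1, a for (d - lam) / n, and let q be the constant vector in
the coordinates of an eigenbasis.  Since it is an eigenvector for d, q is
supported on the eigenvalue d.  If lam < d, that eigenvalue occurs at a single
index k0, so q q^* is diagonal with the only nonzero entry n, and adding
a n = d - lam at k0 turns lam - d into 0.  If lam = d, then a = 0 and the matrix
is d I - A. *)
Lemma shifted_gram (R : realType) (n : nat) (A : 'M[R]_n) (s : seq R) (d : R) :
  A^T = A -> is_spectrum A s -> (1 < n)%N -> (forall x, x \in s -> x <= d) ->
  A *m const_mx 1 = const_mx d :> 'cV_n ->
  exists B : 'M[R]_(n + n, n),
    (s`_1)%:M - A + const_mx ((d - s`_1) / n%:R) = B^T *m B.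
Proof.
move=> Asym spA n1 sled A1; set lam := s`_1; set a := (d - lam) / n%:R.
have n0 : n%:R != 0 :> R by rewrite pnatr_eq0 -lt0n ltnW.
have lamd : lam <= d by apply/sled/mem_nth; rewrite (is_spectrum_size spA).
have [P [D [Pu pDs eA]]] := symmetric_spectral_resolution Asym spA.
have PPt : P *m P^t* = 1%:M by apply/unitarymxP.
have PtP : P^t* *m P = 1%:M by apply: mulmx1C.
pose u : 'cV[R[i]]_n := const_mx 1.
pose q := P *m u.
have Dq k : (D k)%:C * q k 0 = d%:C * q k 0.
  have Au : map_mx (real_complex R) A *m u = d%:C *: u.
    have -> : u = map_mx (real_complex R) (const_mx 1) by rewrite map_const_mx.
    by rewrite -map_mxM A1; apply/colP => i; rewrite !mxE mulr1.
  have /colP/(_ k) : diag_mx (\row_k (D k)%:C) *m q = d%:C *: q.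
    by rewrite {2}/q scalemxAr -Au eA /q !mulmxA PPt mul1mx -!mulmxA.
  by rewrite mul_diag_mx !mxE.
have q0 k : D k != d -> q k 0 = 0.
  move=> Dd; apply/eqP; have /eqP := Dq k.
  rewrite -subr_eq0 -mulrBl mulf_eq0 => /orP[|//].
  by rewrite -rmorphB fmorph_eq0 subr_eq0 (negPf Dd).
have qq : \sum_k q k 0 * (q k 0)^* = n%:R.
  have : (q^t* *m q) 0 0 = n%:R.
    rewrite /q trmx_mul map_mxM -mulmxA (mulmxA _ P) PtP mul1mx mxE.
    rewrite (eq_bigr (fun=> 1)) ?sumr_const ?card_ord // => i _.
    by rewrite !mxE rmorph1 mulr1.
  by rewrite mxE => <-; apply: eq_bigr => k _; rewrite !mxE mulrC.
suff [E E0 eE] : exists2 E : 'I_n -> R, forall k, 0 <= E k &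
    (lam%:C)%:M - diag_mx (\row_k (D k)%:C) + a%:C *: (q *m q^t*) =
      diag_mx (\row_k (E k)%:C).
  apply: (psd_gram (P := P) E0); rewrite -eE.
  rewrite mulmxDr mulmxBr mulmxDl mulmxBl -eA mul_mx_scalar -scalemxAl PtP.
  rewrite scalemx1 -scalemxAr -scalemxAl /q trmx_mul map_mxM !mulmxA PtP mul1mx.
  rewrite -[X in _ + _ *: X]mulmxA PtP mulmx1.
  apply/matrixP => i j.
  by rewrite !mxE big_ord1 !mxE rmorph1 !mulr1 rmorphD rmorphB rmorphMn.
have entry k l : ((lam%:C)%:M - diag_mx (\row_k (D k)%:C)
    + a%:C *: (q *m q^t*)) k l =
    (lam - D k)%:C *+ (k == l) + a%:C * (q k 0 * (q l 0)^*).
  by rewrite !mxE big_ord1 !mxE -mulrnBl rmorphB.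
have diagE (E : 'I_n -> R) k l :
    diag_mx (\row_k (E k)%:C) k l = (E k)%:C *+ (k == l) by rewrite !mxE.
have [lam_d|lam_d|lam_d] := ltgtP lam d; last 1 first.
- exists (fun k => d - D k) => [k|].
    have : D k \in s by rewrite -(perm_mem pDs) map_f // mem_enum.
    by move=> /sled; rewrite subr_ge0.
  apply/matrixP => k l; rewrite entry diagE /a lam_d subrr mul0r.
  by rewrite mul0r addr0.
- have /existsP[k0 qk0] : [exists k, q k 0 != 0].
    apply/contraT => /existsPn qz; move: qq; rewrite big1 => [/esym/eqP|k _].
      by rewrite pnatr_eq0 -leqn0 leqNgt ltnW.
    by move/eqP: (qz k) => /eqP; rewrite negbK => /eqP ->; rewrite mul0r.
  have Dk0 : D k0 = d by apply/eqP; apply: contraNT qk0 => /q0 ->.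
  have small k : k != k0 -> D k <= lam.
    move=> kk0; rewrite leNgt; apply: contraNN kk0 => kl; apply/eqP.
    apply: (spectrum_above_snd pDs) => //; first by case: spA.
    by rewrite Dk0.
  have qz k : k != k0 -> q k 0 = 0.
    by move=> /small kl; apply: q0; rewrite lt_eqF // (le_lt_trans kl).
  exists (fun k => if k == k0 then 0 else lam - D k) => [k|].
    by case: eqP => // /eqP /small; rewrite subr_ge0.
  apply/matrixP => k l; rewrite entry diagE.
  have [->|kk0] := eqVneq k k0; last by rewrite (qz k kk0) mul0r mulr0 addr0.
  have [<-|lk0] := eqVneq k0 l; last first.
    by rewrite (qz l) 1?eq_sym // rmorph0 !mulr0 add0r.
  move: qq; rewrite (bigD1 k0) //= big1 => [|i /qz ->]; last by rewrite mul0r.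
  rewrite addr0 Dk0 => ->.
  have -> : (n%:R : R[i]) = (n%:R : R)%:C by rewrite rmorph_nat.
  rewrite -rmorphM -rmorphD; congr (_%:C).
  by rewrite /a mulfVK // addrC subrKA subrr.
- by rewrite ltNge lamd in lam_d.
Qed.

Local Close Scope sesquilinear_scope.
Local Close Scope complex_scope.

(** * Inequalities for the second eigenvalue of a regular graph *)

Lemma gram_form_ge0 (R : realFieldType) (K T : finType) (b : K -> T -> R)
    (v : T -> R) :
  0 <= \sum_x \sum_y (\sum_k b k x * b k y) * (v x * v y).
Proof.
rewrite (_ : \sum_x _ = \sum_k (\sum_x b k x * v x) ^+ 2).
  by apply: sumr_ge0 => k _; apply: sqr_ge0.
under eq_bigr => x _ do under eq_bigr => y _ do rewrite mulr_suml.
under eq_bigr => x _ do rewrite exchange_big.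
rewrite exchange_big; apply: eq_bigr => k _ /=.
rewrite expr2 mulr_suml; apply: eq_bigr => x _; rewrite mulr_sumr.
by apply: eq_bigr => y _; ring.
Qed.

(** Schur's product theorem, tested against the constant vector: the entrywise
cube is the Gram matrix of the triple tensor powers of the Gram vectors. *)
Lemma gram_cube_ge0 (R : realFieldType) (K T : finType) (b : K -> T -> R) :
  0 <= \sum_x \sum_y (\sum_k b k x * b k y) ^+ 3.
Proof.
rewrite (_ : \sum_x _ =
    \sum_k \sum_l \sum_(m : K) (\sum_x b k x * b l x * b m x) ^+ 2).
  by do 3 (apply: sumr_ge0 => ? _); apply: sqr_ge0.
under [RHS]eq_bigr => k _ do under eq_bigr => l _ do under eq_bigr => m _ do
  (rewrite expr2 mulr_suml; under eq_bigr => x _ do rewrite mulr_sumr).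
under [RHS]eq_bigr => k _ do under eq_bigr => l _ do
  (rewrite exchange_big /=; under eq_bigr => x _ do rewrite exchange_big /=).
under [RHS]eq_bigr => k _ do
  (rewrite exchange_big /=; under eq_bigr => x _ do rewrite exchange_big /=).
rewrite [RHS]exchange_big; apply: eq_bigr => x _ /=.
rewrite [RHS]exchange_big; apply: eq_bigr => y _ /=.
rewrite !exprS expr0 mulr1 mulr_suml; apply: eq_bigr => k _.
rewrite mulrCA mulr_suml; apply: eq_bigr => l _.
rewrite !mulr_sumr.
by apply: eq_bigr => m _; ring.
Qed.

Lemma sum_neighbours (R : pzSemiRingType) (T : finType) (e : rel T) (d : nat) :
  regular_graph e d -> forall x, \sum_y ((e x y)%:R : R) = d%:R.
Proof.
move=> ed x; rewrite -natr_sum -(ed x) cardsE -sum1_card [in RHS]big_mkcond.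
by congr _%:R; apply: eq_bigr => y _; rewrite inE; case: (e x y).
Qed.

Lemma sum_ind (R : pzSemiRingType) (T : finType) (z : T) (F : T -> R) :
  \sum_x (x == z)%:R * F x = F z.
Proof.
rewrite (bigD1 z) //= eqxx mul1r big1 ?addr0 // => x /negPf ->.
by rewrite mul0r.
Qed.

(** Evaluate v A = x v at a coordinate where |v| is largest. *)
Lemma spectrum_le_degree (R : realType) (T : finType) (e : rel T) (d : nat)
    (s : seq R) : symmetric e -> regular_graph e d ->
  is_spectrum (adjacency R e) s -> forall x, x \in s -> x <= d%:R.
Proof.
move=> esym ed [_ es] x xs.
have : eigenvalue (adjacency R e) x.
  by rewrite eigenvalue_root_char es root_prod_XsubC.
case/eigenvalueP=> v vA v0.
have [i0 _] : exists i0 : 'I_#|T|, v 0 i0 != 0.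
  by case/rV0Pn: v0 => i vi; exists i.
case: (arg_maxP (fun i => `|v 0 i|) (isT : xpredT i0)) => i _ imax.
have vi0 : 0 < `|v 0 i|.
  have /rV0Pn[j vj] := v0.
  by apply: lt_le_trans (imax j isT); rewrite normr_gt0.
have : `|x| * `|v 0 i| <= d%:R * `|v 0 i|.
  have /rowP/(_ i) := vA; rewrite !mxE => /(congr1 Num.norm).
  rewrite normrM => <-; apply: (le_trans (ler_norm_sum _ _ _)).
  rewrite -(sum_neighbours R ed (enum_val i)) mulr_suml.
  rewrite [leRHS](reindex _ (onW_bij _ (enum_val_bij T))) /=.
  apply: ler_sum => j _; rewrite !mxE esym normrM normr_nat mulrC.
  by rewrite ler_wpM2l ?ler0n //; apply: imax.
by rewrite ler_pM2r //; apply: le_trans; apply: ler_norm.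
Qed.

Lemma regular_graph_gram (R : realType) (T : finType) (e : rel T) (d : nat)
    (s : seq R) : symmetric e -> regular_graph e d ->
  is_spectrum (adjacency R e) s -> (1 < #|T|)%N ->
  exists (K : finType) (b : K -> T -> R), forall x y,
    s`_1 * (x == y)%:R - (e x y)%:R + (d%:R - s`_1) / #|T|%:R =
      \sum_k b k x * b k y.
Proof.
move=> esym ed es n1.
have A1 : adjacency R e *m const_mx 1 = const_mx d%:R :> 'cV_#|T|.
  apply/colP => i; rewrite !mxE -(sum_neighbours R ed (enum_val i)).
  rewrite [RHS](reindex _ (onW_bij _ (enum_val_bij T))) /=.
  by apply: eq_bigr => j _; rewrite !mxE mulr1.
have [B eB] := shifted_gram (adjacency_sym R esym) es n1
  (spectrum_le_degree esym ed es) A1.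
exists 'I_(#|T| + #|T|), (fun k x => B k (enum_rank x)) => x y.
move/matrixP/(_ (enum_rank x) (enum_rank y)): eB; rewrite !mxE !enum_rankK.
rewrite (inj_eq enum_rank_inj) mulr_natr => ->.
by apply: eq_bigr => k _; rewrite mxE.
Qed.

Lemma regular_graph_form_ge0 (R : realType) (T : finType) (e : rel T) (d : nat)
    (s : seq R) : symmetric e -> regular_graph e d ->
  is_spectrum (adjacency R e) s -> (1 < #|T|)%N -> forall v : T -> R,
  \sum_x \sum_y (e x y)%:R * (v x * v y) <=
    s`_1 * \sum_x v x ^+ 2 + (d%:R - s`_1) / #|T|%:R * (\sum_x v x) ^+ 2.
Proof.
move=> esym ed es n1 v.
have [K [b eb]] := regular_graph_gram esym ed es n1.
rewrite -subr_ge0; have := gram_form_ge0 b v; congr (0 <= _).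
rewrite expr2 mulr_suml !mulr_sumr -big_split -sumrB; apply: eq_bigr => x _ /=.
rewrite [v x ^+ 2]expr2.
rewrite -(sum_ind x (fun y => v x * v y)) !mulr_sumr -big_split -sumrB.
apply: eq_bigr => y _ /=; rewrite -eb (eq_sym y); ring.
Qed.

(** The test vector with entries 1 at x and -1 at y is orthogonal to the
constant vector, so only lam I - A contributes. *)
Lemma snd_eigenvalue_pair (R : realType) (T : finType) (e : rel T) (d : nat)
    (s : seq R) : symmetric e -> irreflexive e -> regular_graph e d ->
  is_spectrum (adjacency R e) s -> forall x y, x != y -> - (e x y)%:R <= s`_1.
Proof.
move=> esym eirr ed es x y xy.
have n1 : (1 < #|T|)%N by apply/card_gt1P; exists x, y.
have := regular_graph_form_ge0 esym ed es n1
  (fun z => (z == x)%:R - (z == y)%:R).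
have dif (F : T -> R) :
    \sum_w ((w == x)%:R - (w == y)%:R) * F w = F x - F y.
  by under eq_bigr => w _ do rewrite mulrBl; rewrite sumrB !sum_ind.
rewrite -(eq_bigr _ (fun z _ => mulr1 ((z == x)%:R - (z == y)%:R))).
rewrite (dif (fun=> 1)) subrr expr0n mulr0 addr0.
under [X in _ <= _ * X]eq_bigr => z _ do rewrite expr2.
rewrite dif !eqxx (eq_sym y x) (negPf xy) /=.
have -> : \sum_z \sum_w (e z w)%:R *
    (((z == x)%:R - (z == y)%:R) * ((w == x)%:R - (w == y)%:R)) =
    - (2 * (e x y)%:R) :> R.
  transitivity (\sum_z ((z == x)%:R - (z == y)%:R) *
      ((e z x)%:R - (e z y)%:R : R)).
    apply: eq_bigr => z _; rewrite -(dif (fun w => (e z w)%:R)) mulr_sumr.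
    by apply: eq_bigr => w _; ring.
  by rewrite dif !eirr (esym y x) /=; ring.
by lra.
Qed.

(** The test vector v is the indicator of the neighbourhood of a vertex z plus
t at z.  In the quadratic form of A at v, the edges at z contribute 2 t d and
the edges inside the neighbourhood, which are triangles through z, contribute a
nonnegative amount. *)
Lemma snd_eigenvalue_local (R : realType) (T : finType) (e : rel T) (d : nat)
    (s : seq R) : symmetric e -> irreflexive e -> regular_graph e d ->
  is_spectrum (adjacency R e) s -> (1 < #|T|)%N -> forall t : R,
  2 * t * #|T|%:R * d%:R <=
    s`_1 * #|T|%:R * (d%:R + t ^+ 2) + (d%:R - s`_1) * (d%:R + t) ^+ 2.
Proof.
move=> esym eirr ed es n1 t.
have [z _] : exists z, z \in T by apply/card_gt0P; apply: ltnW.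
have n0 : (0 : R) < #|T|%:R by rewrite ltr0n ltnW.
pose v x : R := (x == z)%:R * t + (e z x)%:R.
have := regular_graph_form_ge0 esym ed es n1 v.
have -> : \sum_x v x = d%:R + t.
  by rewrite big_split /= (sum_ind z (fun=> t)) (sum_neighbours R ed) addrC.
have -> : \sum_x v x ^+ 2 = d%:R + t ^+ 2.
  rewrite -(sum_neighbours R ed z) -(sum_ind z (fun=> t ^+ 2)) -big_split /=.
  apply: eq_bigr => x _; rewrite /v; case: eqVneq => [->|_].
    by rewrite eirr /=; ring.
  by case: (e z x) => /=; ring.
have : 2 * t * d%:R <= \sum_x \sum_y (e x y)%:R * (v x * v y).
  have -> : 2 * t * d%:R = \sum_x \sum_y (e x y)%:R *
      ((x == z)%:R * t * (e z y)%:R + (y == z)%:R * t * (e z x)%:R).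
    have sqe x y : (e x y)%:R * (e x y)%:R = (e x y)%:R :> R.
      by case: (e x y); rewrite ?mulr1 ?mulr0.
    transitivity (\sum_x ((x == z)%:R * \sum_y (t * (e x y)%:R * (e z y)%:R))
        + \sum_x t * (e z x)%:R).
      rewrite sum_ind -mulr_sumr (sum_neighbours R ed).
      under eq_bigr => y _ do rewrite -mulrA sqe.
      by rewrite -mulr_sumr (sum_neighbours R ed); ring.
    rewrite -big_split; apply: eq_bigr => x _ /=.
    rewrite -[X in _ + X](sum_ind z (fun y => t * (e z x)%:R)).
    under [in RHS]eq_bigr => y _ do rewrite mulrDr.
    rewrite big_split mulr_sumr /=; congr (_ + _); apply: eq_bigr => y _.
      by ring.
    case: eqVneq => [->|_]; last by rewrite /=; ring.
    by rewrite (esym x z) !mul1r mulrCA sqe.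
  apply: ler_sum => x _; apply: ler_sum => y _; rewrite ler_wpM2l //.
  rewrite /v -subr_ge0.
  rewrite [X in 0 <= X](_ : _ = (x == z)%:R * (y == z)%:R * t ^+ 2
    + (e z x)%:R * (e z y)%:R); last by ring.
  by apply: addr_ge0; rewrite 1?mulr_ge0 ?sqr_ge0 ?mulr_ge0 ?ler0n.
move=> H1 /(le_trans H1); rewrite -(ler_pM2r n0).
rewrite [leLHS](_ : _ = 2 * t * #|T|%:R * d%:R); last by ring.
rewrite [leRHS](_ : _ = s`_1 * #|T|%:R * (d%:R + t ^+ 2) +
  (d%:R - s`_1) * (d%:R + t) ^+ 2) //.
by field; rewrite gt_eqF.
Qed.

(** Each row of lam I - A + a J has one entry lam + a, d entries a - 1 and
n - 1 - d entries a; their cubes sum to the same number for every row. *)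
Lemma snd_eigenvalue_cube (R : realType) (T : finType) (e : rel T) (d : nat)
    (s : seq R) : symmetric e -> irreflexive e -> regular_graph e d ->
  is_spectrum (adjacency R e) s -> (1 < #|T|)%N ->
  forall a, a = (d%:R - s`_1) / #|T|%:R ->
  d%:R * (1 - a) ^+ 3 <= (s`_1 + a) ^+ 3 + (#|T|%:R - 1 - d%:R) * a ^+ 3.
Proof.
move=> esym eirr ed es n1 a ea.
have n0 : (0 : R) < #|T|%:R by rewrite ltr0n ltnW.
have [K [b eb]] := regular_graph_gram esym ed es n1.
have := gram_cube_ge0 b.
have rowE x : \sum_y (\sum_k b k x * b k y) ^+ 3 =
    (s`_1 + a) ^+ 3 + (#|T|%:R - 1 - d%:R) * a ^+ 3 - d%:R * (1 - a) ^+ 3.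
  have -> : \sum_y (\sum_k b k x * b k y) ^+ 3 =
      \sum_y (a ^+ 3 + (y == x)%:R * ((s`_1 + a) ^+ 3 - a ^+ 3)
        - (e x y)%:R * ((1 - a) ^+ 3 + a ^+ 3)).
    apply: eq_bigr => y _; rewrite -eb -ea eq_sym.
    case: eqVneq => [->|_]; first by rewrite eirr /=; ring.
    by case: (e x y) => /=; ring.
  rewrite sumrB big_split /= (sum_ind x (fun=> _)) sumr_const.
  rewrite -mulr_suml (sum_neighbours R ed) -[_ *+ #|_|]mulr_natl.
  ring.
under eq_bigr => x _ do rewrite rowE.
by rewrite sumr_const pmulrn_lge0 ?subr_ge0 // ltnW.
Qed.

Lemma degree_lt_card (T : finType) (e : rel T) (d : nat) :
  irreflexive e -> regular_graph e d -> (0 < #|T|)%N -> (d < #|T|)%N.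
Proof.
move=> eirr ed T0; rewrite -(prednK T0) ltnS.
have /card_gt0P[x _] := T0; rewrite -(ed x) cardsE -(cardC1 x).
apply/subset_leq_card/fintype.subsetP => y.
by rewrite -!topredE /=; apply: contraTneq => ->; rewrite eirr.
Qed.

(** Apply the pair bound to two distinct nonadjacent vertices, which exist
unless the graph is complete. *)
Lemma snd_eigenvalue_ge0 (R : realType) (T : finType) (e : rel T) (d : nat)
    (s : seq R) : symmetric e -> irreflexive e -> regular_graph e d ->
  is_spectrum (adjacency R e) s -> (d.+1 < #|T|)%N -> 0 <= s`_1.
Proof.
move=> esym eirr ed es dn.
have [x _] : exists x, x \in T by apply/card_gt0P; apply: leq_trans dn.
have /fintype.subsetPn[y] : ~~ (predC1 x \subset [pred y | e x y]).
  apply: contraL dn => /subset_leq_card.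
  have -> : #|[pred y | e x y]| = d by rewrite -(ed x) cardsE.
  by rewrite cardC1 -leqNgt -subn1 leq_subLR.
rewrite !inE eq_sym => xy /negPf exy.
by have := snd_eigenvalue_pair esym eirr ed es xy; rewrite exy oppr0.
Qed.

(** * The three ranges of the degree *)

(** Here d = q^2 and t = q, and h is the cube root of n.  After division by q^2
the local inequality reads
    lam (2 n - (q + 1)^2) >= 2 n q - q^2 (q + 1)^2,
where q^4 <= n q because q <= h, so that the right-hand side is n q up to lower
order terms.  If lam < 0 this is only possible for h <= 3, and then the
claimed bound is at most -1. *)
Lemma sqrt_bound_of_local (R : realFieldType) (n lam q h : R) :
  1 <= q -> q <= h -> n = h ^+ 3 -> q ^+ 2 + 1 <= n ->
  -1 <= lam ->
  lam * n * (q ^+ 2 + q ^+ 2) + (q ^+ 2 - lam) * (q ^+ 2 + q) ^+ 2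
     >= 2 * q * n * q ^+ 2 ->
  q / 2 * (1 - 9 / h) <= lam.
Proof.
move=> q1 qh en cs lam1 key.
have h1 : 1 <= h by lra.
have h0 : 0 < h by lra.
have q20 : 0 < q ^+ 2 by nra.
(* This makes the coefficient of lam nonnegative. *)
have {}cs : (q + 1) ^+ 2 <= 2 * n by have := sqr_ge0 (q - 1); nra.
have {}key : 2 * n * q - q ^+ 2 * (q + 1) ^+ 2 <= lam * (2 * n - (q + 1) ^+ 2).
  rewrite -(ler_pM2l q20); nra.
have q3 : q ^+ 3 <= n by rewrite en lerXn2r ?nnegrE //; lra.
have q4 : q ^+ 4 <= n * q by rewrite exprSr ler_pM2r //; lra.
have -> : q / 2 * (1 - 9 / h) = q * (h - 9) / (2 * h) by field; lra.
rewrite ler_pdivrMr ?mulr_gt0 //.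
have [lam0|lam0] := leP 0 lam.
  have l2 : 0 <= lam * (q + 1) ^+ 2 by rewrite mulr_ge0 // sqr_ge0.
  have : n * q - 2 * q ^+ 3 - q ^+ 2 <= 2 * n * lam by nra.
  rewrite -(ler_pM2r (exprn_gt0 2 h0)) => H.
  rewrite -(ler_pM2r (exprn_gt0 2 h0)).
  have E : lam * (2 * h) * h ^+ 2 = 2 * n * lam by rewrite en; ring.
  have E2 : q * (h - 9) * h ^+ 2 = n * q - 9 * q * h ^+ 2 by rewrite en; ring.
  nra.
have rhs0 : lam * (2 * n - (q + 1) ^+ 2) <= 0 by nra.
have : 2 * n <= q * (q + 1) ^+ 2.
  have q0 : 0 < q by lra.
  rewrite -(ler_pM2l q0); nra.
have : q * (q + 1) ^+ 2 <= h * (h + 1) ^+ 2.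
  by apply: ler_pM; rewrite ?sqr_ge0 ?lerXn2r ?nnegrE //; lra.
rewrite en => H1 H2.
have h3 : h <= 3.
  rewrite leNgt; apply/negP => h3; nra.
nra.
Qed.

(** Put r = d / n and t = 2 r d.  After division by d^2 / r the local inequality
reads lam C >= r d (1 - 2 r) (3 + 2 r) with C = 1 + 4 r^2 d - r (1 + 2 r)^2 > 0,
and the target is lam >= (1 - 2 r) / (2 r).  It remains to see that
2 r^2 d (3 + 2 r) >= C, which holds because r^2 d = d^3 / n^2 >= 1. *)
Lemma ratio_bound_of_local (R : realFieldType) (n d lam : R) :
  0 < d -> n ^+ 2 <= d ^+ 3 -> 2 * d < n ->
  (forall t,
    2 * t * n * d <= lam * n * (d + t ^+ 2) + (d - lam) * (d + t) ^+ 2) ->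
  n / (2 * d) - 1 <= lam.
Proof.
move=> d0 nd dn key.
have n0 : 0 < n by lra.
pose r := d / n.
have r0 : 0 < r by rewrite divr_gt0.
have r2 : 2 * r < 1 by rewrite /r mulrA ltr_pdivrMr // mul1r.
have en : n = d / r by rewrite /r; field; lra.
have v1 : 1 <= r ^+ 2 * d.
  by rewrite /r exprMn exprVn mulrAC ler_pdivlMr ?exprn_gt0 // mul1r -exprSr.
have K : r * d * (1 - 2 * r) * (3 + 2 * r)
    <= lam * (1 + 4 * (r ^+ 2 * d) - r * (1 + 2 * r) ^+ 2).
  have d2r : 0 < d ^+ 2 / r by rewrite divr_gt0 // exprn_gt0.
  rewrite -(ler_pM2l d2r) -subr_ge0.
  have := key (2 * r * d); rewrite en -subr_ge0; congr (0 <= _).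
  by field; lra.
have -> : n / (2 * d) - 1 = (1 - 2 * r) / (2 * r) by rewrite /r; field; lra.
rewrite ler_pdivrMr; last by lra.
have C0 : 0 < 1 + 4 * (r ^+ 2 * d) - r * (1 + 2 * r) ^+ 2.
  have : r * (1 + 2 * r) ^+ 2 <= 2 by nra.
  by lra.
rewrite -(ler_pM2r C0) [leRHS](_ : _ = 2 * r *
  (lam * (1 + 4 * (r ^+ 2 * d) - r * (1 + 2 * r) ^+ 2))); last by ring.
have r20 : 0 < 2 * r by lra.
rewrite -(ler_pM2l r20) in K; refine (le_trans _ K).
rewrite [leRHS](_ : _ = (1 - 2 * r) * (2 * (r ^+ 2 * d) * (3 + 2 * r)));
  last by ring.
rewrite ler_pM2l; last by lra.
have : 0 <= r * (1 + 2 * r) ^+ 2 by rewrite mulr_ge0 ?sqr_ge0 // ltW.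
by nra.
Qed.

(** With r = d / n, the function d (1 - a)^3 - (n - d) a^3 decreases for a in
[0, r], and at a = r it equals d (1 - r) (1 - 2 r) >= d * (1/2) * (2 eps). *)
Lemma cbrt_bound_of_cube (R : realFieldType) (n d lam eps : R) :
  0 < n -> 0 < d -> 0 <= lam -> lam <= d -> d <= (1 / 2 - eps) * n -> 0 < eps ->
  let a := (d - lam) / n in
  d * (1 - a) ^+ 3 <= (lam + a) ^+ 3 + (n - 1 - d) * a ^+ 3 ->
  eps * d <= (lam + 1) ^+ 3.
Proof.
move=> n0 d0 lam0 lamd dn eps0 a cube.
pose r := d / n.
have a0 : 0 <= a by rewrite divr_ge0 ?subr_ge0 // ltW.
have ar : a <= r by rewrite ler_pM2r ?invr_gt0 //; lra.
have reps : r <= 1 / 2 - eps by rewrite ler_pdivrMr.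
have ed : d = r * n by rewrite /r; field; lra.
have a3 : 0 <= a ^+ 3 by rewrite exprn_ge0.
have ar3 : a ^+ 3 <= r ^+ 3 by rewrite lerXn2r ?nnegrE //; lra.
have ar3' : (1 - r) ^+ 3 <= (1 - a) ^+ 3 by rewrite lerXn2r ?nnegrE //; lra.
have : (lam + a) ^+ 3 <= (lam + 1) ^+ 3 by rewrite lerXn2r ?nnegrE //; lra.
move=> la1; refine (le_trans _ la1).
have H1 : d * (1 - r) ^+ 3 <= d * (1 - a) ^+ 3 by rewrite ler_pM2l.
have H2 : (n - d) * a ^+ 3 <= (n - d) * r ^+ 3 by rewrite ler_wpM2l //; nra.
have H3 : d * (1 - r) ^+ 3 - (n - d) * r ^+ 3 = d * ((1 - r) * (1 - 2 * r)).
  by rewrite ed; ring.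
have H4 : d * eps <= d * ((1 - r) * (1 - 2 * r)) by rewrite ler_pM2l //; nra.
by lra.
Qed.

(** * Fractional powers *)

Lemma exprn_powR (R : realType) (x r : R) (k : nat) :
  (x `^ r) ^+ k = x `^ (r * k%:R).
Proof. by rewrite -powR_mulrn ?powR_ge0 // -powRrM. Qed.

Lemma cbrtK (R : realType) (x : R) : 0 <= x -> (x `^ (1 / 3)) ^+ 3 = x.
Proof. by move=> x0; rewrite exprn_powR mul1r mulVf ?powRr1 // pnatr_eq0. Qed.

Lemma cvg_inv_cbrt (R : realType) (c : R) : 0 < c ->
  c / (n%:R : R) `^ (1 / 3) @[n --> \oo] --> (0 : R).
Proof.
move=> c0; apply/cvgrPdist_lt => eps eps0; near=> n.
have ce0 : 0 < c / eps by rewrite divr_gt0.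
have nbig : (c / eps) ^+ 3 < n%:R by near: n; apply: nbhs_infty_gtr.
have h : c / eps < n%:R `^ (1 / 3).
  by rewrite -(ltr_pXn2r (n := 3)) ?nnegrE ?powR_ge0 ?ltW // cbrtK.
have h0 := lt_trans ce0 h.
rewrite sub0r normrN ger0_norm ?divr_ge0 ?ltW //.
by rewrite ltr_pdivrMr // mulrC -ltr_pdivrMr.
Unshelve. all: by end_near.
Qed.

Theorem theorem1p1 (R : realType) :
  exists delta : nat -> R,
    (delta n @[n --> \oo] --> (0 : R)) /\
    forall (T : finType) (e : rel T) (d : nat) (lambda : seq R),
      symmetric e -> irreflexive e -> regular_graph e d ->
      is_spectrum (adjacency R e) lambda ->
      forall eps : R, 0 < eps ->
        [/\ 1 <= (d%:R : R) <= (#|T|%:R : R) `^ (2 / 3) ->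
              lambda`_1 >= Num.sqrt d%:R / 2 * (1 - delta #|T|),
            (#|T|%:R : R) `^ (2 / 3) < d%:R <= (#|T|%:R : R) `^ (3 / 4) ->
              lambda`_1 >= #|T|%:R / (2 * d%:R) - 1
          & (#|T|%:R : R) `^ (3 / 4) < d%:R <= (1 / 2 - eps) * #|T|%:R ->
              lambda`_1 >= (eps / 4) `^ (1 / 3) * d%:R `^ (1 / 3) - 1].
Proof.
exists (fun n => 9 / n%:R `^ (1 / 3)); split; first exact: cvg_inv_cbrt.
move=> T e d s esym eirr ed es eps eps0.
set lam := s`_1; set n : R := #|T|%:R.
have n_ge0 : 0 <= n by rewrite ler0n.
have [T0|T_gt0] := posnP #|T|.
  have n0 : n = 0 by rewrite /n T0.
  have pow0 r : r != 0 -> n `^ r = 0 by move=> r0; rewrite n0 powR0.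
  split; rewrite ?pow0 ?n0 ?mulr0 ?mulf_neq0 ?invr_neq0 ?pnatr_eq0 //;
    move=> /andP[d1 d2].
  - by move: (le_trans d1 d2); rewrite ler10.
  - by move: (lt_le_trans d1 d2); rewrite ltxx.
  - by move: (lt_le_trans d1 d2); rewrite ltxx.
have n_gt0 : 0 < n by rewrite ltr0n.
have dn : (d < #|T|)%N := degree_lt_card eirr ed T_gt0.
have dnR : d%:R + 1 <= n by rewrite natr1 ler_nat.
have n1 : 0 < d%:R :> R -> (1 < #|T|)%N.
  by rewrite ltr0n => d0; apply: leq_ltn_trans dn.
split=> /andP[dlo dhi].
- have d0 : 0 < d%:R :> R by lra.
  have {}n1 := n1 d0.
  pose q := Num.sqrt d%:R : R.
  have eq2 : q ^+ 2 = d%:R by rewrite sqr_sqrtr // ltW.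
  apply: (sqrt_bound_of_local (n := n)).
  + by rewrite -[leLHS]sqrtr1 ler_wsqrtr.
  + rewrite -(ler_pXn2r (n := 2)) ?nnegrE ?powR_ge0 ?sqrtr_ge0 //.
    by rewrite -/q eq2 exprn_powR mul1r mulrC.
  + by rewrite cbrtK.
  + by rewrite -/q eq2.
  + have /card_gt1P[x [y [_ _ xy]]] := n1.
    apply: le_trans (snd_eigenvalue_pair esym eirr ed es xy).
    by case: (e x y); rewrite ?lexx // oppr0 lerN10.
  + have := snd_eigenvalue_local esym eirr ed es n1 q.
    by rewrite -/q eq2.
- have d0 : 0 < d%:R :> R by apply: le_lt_trans dlo; apply: powR_ge0.
  have nd : n ^+ 2 < d%:R ^+ 3.
    have -> : n ^+ 2 = (n `^ (2 / 3)) ^+ 3.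
      by rewrite exprn_powR mulfVK ?pnatr_eq0 // powR_mulrn.
    by rewrite ltr_pXn2r ?nnegrE ?powR_ge0 // ltW.
  have dn4 : d%:R ^+ 4 <= n ^+ 3.
    have -> : n ^+ 3 = (n `^ (3 / 4)) ^+ 4.
      by rewrite exprn_powR mulfVK ?pnatr_eq0 // powR_mulrn.
    by rewrite lerXn2r ?nnegrE ?powR_ge0 // ltW.
  have [d2|d2] := ltP (2 * d%:R) n.
    apply: ratio_bound_of_local => // [|t]; first exact: ltW.
    exact: (snd_eigenvalue_local esym eirr ed es (n1 d0)).
  have x0 : n / (2 * d%:R) - 1 <= 0.
    by rewrite subr_le0 ler_pdivrMr ?mul1r // mulr_gt0.
  (* In a complete graph n = d + 1, but then n^2 < d^3 forces d >= 3, hence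
     d^4 > n^3. *)
  apply: (le_trans x0); apply: (snd_eigenvalue_ge0 esym eirr ed es).
  rewrite ltn_neqAle dn andbT; apply/eqP => dT.
  move: nd dn4; rewrite /n -dT -!natrX ltr_nat ler_nat => nd dn4.
  case: d nd dn4 {ed dn dnR n1 dlo dhi d0 d2 x0 dT} => [|[|[|d]]] //.
  nia.
- have d0 : 0 < d%:R :> R by apply: le_lt_trans dlo; apply: powR_ge0.
  have lam_d : lam <= d%:R.
    apply: (spectrum_le_degree esym ed es); rewrite mem_nth //.
    by rewrite (is_spectrum_size es) n1.
  have d2 : 2 * d%:R < n by nra.
  have d1 : (1 : R) <= d%:R by rewrite ler1n -(ltr0n R).
  have lam0 : 0 <= lam.
    apply: (snd_eigenvalue_ge0 esym eirr ed es).
    by rewrite -(ltr_nat R) -natr1 -/n; lra.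
  have lam3 : eps * d%:R <= (lam + 1) ^+ 3.
    apply: cbrt_bound_of_cube dhi eps0 _ => //.
    exact: (snd_eigenvalue_cube esym eirr ed es (n1 d0) erefl).
  have e4 : 0 <= eps / 4 by rewrite divr_ge0 // ltW.
  rewrite lerBlDr -powRM ?ler0n //.
  have ed0 : 0 <= eps / 4 * d%:R by rewrite mulr_ge0.
  rewrite -(ler_pXn2r (n := 3)) ?nnegrE ?powR_ge0 ?addr_ge0 // cbrtK //.
  by apply: le_trans lam3; nra.
Qed.
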